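(* Let $q$ be a prime power and $n \ge 1$. For every ideal $Q$ in $\mathcal{L}_n$ and every $1 \le k \le n-1$, if $\mu_k(Q) = (1+z)^{-1}$ with $z \in \mathbb{R}_{\ge 0}$, then $\mu_{k-1}(Q) \ge (1+(z/q))^{-1}$ and $\mu_{k+1}(Q) \le (1+qz)^{-1}$. As a consequence, there is an absolute constant $C>0$ such that for every $0<\varepsilon<1$, every ideal $Q$ in $\mathcal{L}_n$ and all integers $0\le k \le \ell \le n$ with $\mu_k(Q) \le 1-\varepsilon$ and $\ell \ge k + C\log_q(1/\varepsilon)$, one has $\mu_\ell(Q) \le \varepsilon$.
   Context: $\mathbb{F}_q$ is the finite field with $q$ elements. $\mathcal{L}_n$ is the lattice of linear subspaces of $(\mathbb{F}_q)^n$ ordered by inclusion, and $\mathcal{L}_{n,k}$ is the set of $k$-dimensional subspaces. An ideal in $\mathcal{L}_n$ is a subset $Q \subseteq \mathcal{L}_n$ that is downward closed: $A \in Q$ and $B \subseteq A$ a subspace imply $B \in Q$. For $0 \le k \le n$, $\mu_k(Q) = |Q \cap \mathcal{L}_{n,k}|/|\mathcal{L}_{n,k}|$ is the fraction of $k$-dimensional subspaces belonging to $Q$. *)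

(* Defs.v *)
From HB Require Import structures.
From mathcomp Require Import all_boot all_order all_algebra all_field.
From mathcomp Require Import all_classical all_reals all_analysis.
Set Implicit Arguments. Unset Strict Implicit. Unset Printing Implicit Defensive.
Import Order.TTheory GRing.Theory Num.Theory.
Local Open Scope ring_scope.

Definition linsub (F : finFieldType) (n : nat) := {vspace 'rV[F]_n}.
HB.instance Definition _ (F : finFieldType) (n : nat) :=
  Finite.copy (linsub F n)
    (can_type (@vector.VectorInternalTheory.vs2mxK F 'rV[F]_n)).

Definition Lnk (F : finFieldType) (n k : nat) : {set linsub F n} :=
  [set U : linsub F n | \dim U == k].

Definition is_ideal (F : finFieldType) (n : nat) (Q : {set linsub F n}) : Prop :=
  forall A B : linsub F n, A \in Q -> (B <= A)%VS -> B \in Q.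

Definition mu (R : realType) (F : finFieldType) (n : nat)
    (Q : {set linsub F n}) (k : nat) : R :=
  (#|Q :&: Lnk F n k|%:R / #|Lnk F n k|%:R)%R.

Definition qof (F : finFieldType) : nat := #|F|.

(* Main.v *)
(* Between adjacent levels k and k+1 of the subspace lattice, the inclusion
   operators U (up) and D (down) are adjoint and satisfy
   DU = UD + ([n-k] - [k]) on level k, where [m] = 1 + q + ... + q^(m-1).
   By induction on k, |Uf|^2 <= q [k] [n-k-1] |f|^2 for every mean-zero f on
   level k.  No (k+1)-space in Q contains a k-space outside Q, so the
   expander-mixing argument gives
     mu_(k+1) (1 - mu_k) [k+1] [n-k] <= (1 - mu_(k+1)) mu_k q [k] [n-k-1],
   and since q [m] = [m+1] - 1 this yields
     q mu_(k+1) (1 - mu_k) <= (1 - mu_(k+1)) mu_k: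
   the odds against membership in Q grow at least by a factor q per level.
   Iterating this bound proves the threshold statement with C = 2. *)
Require Import Defs.
From HB Require Import structures.
From mathcomp Require Import all_boot all_order all_algebra all_field.
From mathcomp Require Import all_classical all_reals all_analysis.
From mathcomp Require Import ring lra zify.
Set Implicit Arguments.
Unset Strict Implicit.
Import Order.TTheory GRing.Theory Num.Theory.
Local Open Scope ring_scope.

(** * Gaussian integers and basic dimension facts *)

Definition qnum (q m : nat) : nat := (\sum_(i < m) q ^ i)%N.

Lemma qnumS q m : qnum q m.+1 = (1 + q * qnum q m)%N.
Proof.
rewrite /qnum big_ord_recl expn0 big_distrr /=; congr (_ + _)%N.
by apply: eq_bigr => i _; rewrite expnS.
Qed.

Lemma qnum_expn q m : (0 < q)%N -> (q.-1 * qnum q m = q ^ m - 1)%N.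
Proof. by move=> q0; rewrite subn1 predn_exp. Qed.

Lemma dim_add_vline (F : finFieldType) (n : nat) (K : {vspace 'rV[F]_n}) v :
  v \notin K -> \dim (K + <[v]>)%VS = (\dim K).+1.
Proof.
move=> vK; apply/eqP; rewrite eqn_leq; apply/andP; split.
  apply: leq_trans (dimv_add_leqif K <[v]>%VS) _.
  by rewrite -[(\dim K).+1]addn1 leq_add2l dim_vline leq_b1.
have [le_dim eq_dim] := dimv_leqif_sup (addvSl K <[v]>%VS).
rewrite ltn_neqAle le_dim eq_dim andbT.
by rewrite subv_add negb_and -memvE vK orbT.
Qed.

Lemma eq_subspace_dim (K : fieldType) (vT : vectType K) (U V : {vspace vT}) :
  (U <= V)%VS -> (\dim V <= \dim U)%N -> U = V.
Proof. by move=> UV dVU; apply/eqP; rewrite eqEdim UV. Qed.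

(** * Counting the subspaces just above or just below a given one *)

Section Counting.
Variables (F : finFieldType) (n : nat).
Local Notation q := #|F|.
Local Notation T := (linsub F n).

Lemma card_spaceD (K V : T) : (K <= V)%VS ->
  #|[set v : 'rV[F]_n | (v \in V) && (v \notin K)]| = (q ^ \dim V - q ^ \dim K)%N.
Proof.
move=> KV; rewrite -!card_vspace.
have sub : {subset K <= V} by move=> v; apply: (subvP KV).
have <- : #|[set v in V] :&: [set v in K]| = #|K|.
  rewrite -(cardsE (mem K)); apply: eq_card => v; rewrite !inE andbC.
  by apply: andb_idr; apply: sub.
rewrite -(cardsE (mem V)) -cardsD; apply: eq_card => v; rewrite !inE andbC //.
Qed.

(** Each vector v of V outside K yields one such W, namely K + <v>, and each W arises from its
    q^(k+1) - q^k vectors outside K, where k = dim K. Dividing q^(dim V) - q^k by this fibre size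
    leaves a Gaussian integer. *)
Lemma card_covers (K V : T) : (K <= V)%VS ->
  #|[set W : T | [&& \dim W == (\dim K).+1, (K <= W)%VS & (W <= V)%VS]]|
  = qnum q (\dim V - \dim K).
Proof.
move=> KV; set B := [set W : T | _].
have q1 : (1 < q)%N by apply: finNzRing_gt1.
pose S := [set v : 'rV[F]_n | (v \in V) && (v \notin K)].
pose f (v : 'rV[F]_n) : T := (K + <[v]>)%VS.
have cS : #|S| = \sum_(W in B) (q ^ (\dim K).+1 - q ^ \dim K)%N.
  rewrite -sum1_card (partition_big f (mem B)) /=; last first.
    move=> v; rewrite !inE => /andP[vV vK].
    by rewrite dim_add_vline // eqxx addvSl subv_add KV -memvE vV.
  apply: eq_bigr => W; rewrite inE => /and3P[/eqP dW KW WV].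
  rewrite -dW -card_spaceD // -sum1_card; apply: eq_bigl => v.
  rewrite !inE; apply/andP/andP => [[/andP[vV vK] /eqP <-]|[vW vK]].
    by split=> //; rewrite memvE addvSr.
  split; first by rewrite vK (subvP WV).
  apply/eqP; apply: eq_subspace_dim; first by rewrite subv_add KW -memvE vW.
  by rewrite dim_add_vline // dW.
move: cS; rewrite sum_nat_const card_spaceD //.
rewrite -[in LHS](subnKC (dimvS KV)) expnD expnSr.
set a := (q ^ \dim K)%N; set m := (\dim V - \dim K)%N => cS.
have a0 : (0 < a)%N by rewrite expn_gt0; lia.
have: (a * (q.-1 * #|B|) = a * (q.-1 * qnum q m))%N.
  rewrite qnum_expn; last by lia.
  by rewrite mulnBr muln1 cS -[X in (_ * q - X)%N]muln1 -mulnBr subn1 mulnA [RHS]mulnC.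
by move/eqP; rewrite eqn_pmul2l // eqn_pmul2l ?(eqP) => [/eqP //|]; lia.
Qed.

Lemma subspace_of_dim (V : T) j : (j <= \dim V)%N ->
  exists2 U : T, (U <= V)%VS & \dim U = j.
Proof.
move=> jV; have /andP[/eqP sb fb] := vbasisP V.
have sz : size (vbasis V) = \dim V by rewrite size_tuple.
exists <<take j (vbasis V)>>%VS.
  by rewrite -[X in (_ <= X)%VS]sb; apply: sub_span => x; apply: mem_take.
move: fb; rewrite -{1}(cat_take_drop j (vbasis V)) => /catl_free /eqP ->.
by rewrite size_takel // sz.
Qed.

(** Two distinct hyperplanes of V span V, so the dimension formula settles the size of their
    intersection. *)
Lemma dim_cap_facets (V H H0 : T) : (H <= V)%VS -> (H0 <= V)%VS ->
  (\dim H).+1 = \dim V -> (\dim H0).+1 = \dim V -> H != H0 ->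
  (\dim (H :&: H0)%VS).+1 = \dim H0.
Proof.
move=> HV H0V dH dH0 neq.
have := dimv_sum_cap H H0.
have le1 : (\dim (H + H0)%VS <= \dim V)%N by apply: dimvS; rewrite subv_add HV.
have lt1 : (\dim H0 < \dim (H + H0)%VS)%N.
  have [le_dim eq_dim] := dimv_leqif_sup (addvSr H H0).
  rewrite ltn_neqAle le_dim eq_dim andbT subv_add subvv andbT.
  apply: contra neq => HH0; apply/eqP; apply: eq_subspace_dim HH0 _.
  by rewrite -ltnS dH dH0.
lia.
Qed.

Lemma card_facets (V : T) :
  #|[set H : T | ((\dim H).+1 == \dim V) && (H <= V)%VS]| = qnum q (\dim V).
Proof.
move dV: (\dim V) => m.
elim: m V dV => [|m IH] V dV.
  by rewrite /qnum big_ord0; apply/eqP; rewrite cards_eq0; apply/eqP/setP => H; rewrite !inE.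
have [|H0 H0V dH0] := @subspace_of_dim V m; first by rewrite dV.
rewrite (cardsD1 H0) inE dH0 H0V eqxx qnumS -(IH H0) //; congr (_ + _)%N.
(* Every facet H <> H0 meets H0 in a facet of H0, and each facet of H0 arises
   from q such H: [m+1] = 1 + q [m]. *)
rewrite -sum1_card (partition_big (fun H : T => (H :&: H0)%VS : T)
  (mem [set K : T | ((\dim K).+1 == m) && (K <= H0)%VS])) /=; last first.
  move=> H; rewrite !inE eqSS => /andP[neq /andP[/eqP dH HV]].
  by rewrite capvSr andbT -dH0; apply/eqP; apply: (dim_cap_facets HV) => //; lia.
rewrite mulnC -sum_nat_const; apply: eq_bigr => K.
rewrite inE => /andP[/eqP dK KH0].
have KV := subv_trans KH0 H0V.
(* K has codimension 2 in V, so [2] = q + 1 hyperplanes of V contain it; discarding H0 leaves q. *)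
have -> : q = (qnum q (\dim V - \dim K)).-1.
  have -> : (\dim V - \dim K = 2)%N by lia.
  by rewrite !qnumS /qnum big_ord0 muln0 muln1.
rewrite -card_covers // (cardsD1 H0) inE dH0 dK KH0 H0V eqxx /= -sum1_card.
apply: eq_bigl => H; rewrite !inE eqSS.
case: (eqVneq H H0) => //= neq; apply/andP/and3P => [[/andP[dH HV] /eqP <-]|[dH KH HV]].
  by rewrite capvSl.
split; first by rewrite dH.
apply/eqP; apply/esym; apply: eq_subspace_dim; first by rewrite subv_cap KH KH0.
by rewrite -ltnS (@dim_cap_facets V H H0) // ?(eqP dH) ?dH0 ?dK // dV.
Qed.
End Counting.

(** With X, Y the sums of squares and S the sum of products, expanding the sum of (Y x_i - S y_i)^2
    gives Y (X Y - S^2). If Y = 0, every y_i vanishes. *)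
Lemma Cauchy_Schwarz_sum (R : realFieldType) (I : finType) (P : pred I) (x y : I -> R) :
  (\sum_(i | P i) x i * y i) ^+ 2
    <= (\sum_(i | P i) x i ^+ 2) * (\sum_(i | P i) y i ^+ 2).
Proof.
set S := \sum_(i | P i) _; set X := \sum_(i | P i) _; set Y := \sum_(i | P i) _.
have Y0 : 0 <= Y by apply: sumr_ge0 => i _; apply: sqr_ge0.
have [Yz|Yn] := eqVneq Y 0.
  suff -> : S = 0 by rewrite Yz mulr0 expr0n.
  apply: big1 => i Pi; move/eqP: Yz; rewrite psumr_eq0 => [|j _]; last exact: sqr_ge0.
  by move=> /allP /(_ i (mem_index_enum i)); rewrite Pi sqrf_eq0 => /eqP ->; rewrite mulr0.
have : 0 <= \sum_(i | P i) (Y * x i - S * y i) ^+ 2.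
  by apply: sumr_ge0 => i _; apply: sqr_ge0.
have -> : \sum_(i | P i) (Y * x i - S * y i) ^+ 2 = Y * (X * Y - S ^+ 2).
  transitivity (\sum_(i | P i) (Y ^+ 2 * x i ^+ 2 - 2 * Y * S * (x i * y i) + S ^+ 2 * y i ^+ 2)).
    by apply: eq_bigr => i _; ring.
  by rewrite big_split /= sumrB -!mulr_sumr -/X -/Y -/S; ring.
by rewrite pmulr_rge0 ?subr_ge0 // lt_def Yn.
Qed.

(** * The inclusion operators between levels and their norm on mean-zero functions *)

Section Spectral.
Variables (R : realFieldType) (F : finFieldType) (n : nat).
Local Notation q := #|F|.
Local Notation T := (linsub F n).
Implicit Types (U V W : T) (f g : T -> R).

Lemma dim_full : \dim {:'rV[F]_n} = n.
Proof. by rewrite dimvf /dim /= mul1n. Qed.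

(** In [up] and [down] alike, [k] is the level summed over; the level of the output is left open,
    and values off level [k] are ignored. *)
Definition up k f W : R := \sum_(V : T | (\dim V == k) && (V <= W)%VS) f V.
Definition down k g V : R := \sum_(W : T | (\dim W == k) && (V <= W)%VS) g W.

Lemma up_down_adjoint j k f g :
  \sum_(W : T | \dim W == j) g W * up k f W
  = \sum_(V : T | \dim V == k) down j g V * f V.
Proof.
transitivity (\sum_(W : T | \dim W == j) \sum_(V : T | (\dim V == k) && (V <= W)%VS) g W * f V).
  by apply: eq_bigr => W _; rewrite mulr_sumr.
rewrite (exchange_big_dep (fun V : T => \dim V == k)) /=; last by move=> W V _ /andP[].
apply: eq_bigr => V dV; rewrite mulr_suml; apply: eq_bigl => W.
by rewrite dV.
Qed.

Lemma card_covers_full V :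
  #|[set W : T | (\dim W == (\dim V).+1) && (V <= W)%VS]| = qnum q (n - \dim V).
Proof.
have <- : (\dim {:'rV[F]_n} - \dim V = n - \dim V)%N by rewrite dim_full.
rewrite -(card_covers (subvf V)).
by apply: eq_card => W; rewrite !inE subvf andbT.
Qed.

(** Modularity: either V and U meet in dimension m, and then their sum and their intersection are
    the only candidates, or both counts are 0. This makes the off-diagonal entries of DU and UD
    agree. *)
Lemma card_common_covers m V U : \dim V = m.+1 -> \dim U = m.+1 -> V != U ->
  #|[set W : T | [&& \dim W == m.+2, (V <= W)%VS & (U <= W)%VS]]|
  = #|[set K : T | [&& \dim K == m, (K <= V)%VS & (K <= U)%VS]]|.
Proof.
move=> dV dU neq; have dVU := dimv_sum_cap V U.
have lt1 : (m.+1 < \dim (V + U)%VS)%N.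
  have [le_dim eq_dim] := dimv_leqif_sup (addvSl V U).
  rewrite -dV ltn_neqAle le_dim eq_dim andbT subv_add subvv /=.
  by apply: contra neq => UV; apply/eqP/esym/(eq_subspace_dim UV); rewrite dV dU.
have [dcap|ncap] := eqVneq (\dim (V :&: U)%VS) m; last first.
  rewrite !eq_card0 // => K; rewrite !inE; apply/negP => /and3P[/eqP dK KV KU].
    have : (K <= V :&: U)%VS by rewrite subv_cap KV.
    by move=> /dimvS; lia.
  have : (V + U <= K)%VS by rewrite subv_add KV.
  by move=> /dimvS; lia.
rewrite (_ : [set W : T | _] = [set (V + U)%VS : T]).
  rewrite (_ : [set W : T | _] = [set (V :&: U)%VS : T]) ?cards1 //.
  apply/finset.setP => K; rewrite !inE; apply/and3P/eqP => [[/eqP dK KV KU]| ->].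
    by apply: eq_subspace_dim; rewrite ?subv_cap ?KV ?KU // dK dcap.
  by rewrite dcap capvSl capvSr.
apply/finset.setP => K; rewrite !inE; apply/and3P/eqP => [[/eqP dK KV KU]| ->].
  by apply/esym/eq_subspace_dim; rewrite ?subv_add ?KV ?KU //; lia.
by rewrite addvSl addvSr; split=> //; apply/eqP; lia.
Qed.

(** Both composites are expanded over U on level k+1, weighted by the number of common covers, or
    common facets, of U and V. The weights agree for U != V; at U = V they are [n-k-1] and [k+1]. *)
Lemma down_up k V f : \dim V = k.+1 ->
  down k.+2 (up k.+1 f) V + (qnum q k.+1)%:R * f V
  = up k (down k.+1 f) V + (qnum q (n - k.+1))%:R * f V.
Proof.
move=> dV.
have -> : down k.+2 (up k.+1 f) V = \sum_(U : T | \dim U == k.+1)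
    #|[set W : T | [&& \dim W == k.+2, (V <= W)%VS & (U <= W)%VS]]|%:R * f U.
  rewrite /down /up (exchange_big_dep (fun U : T => \dim U == k.+1)) /=; last first.
    by move=> W U _ /andP[].
  apply: eq_bigr => U dU; rewrite dU mulr_natl -sumr_const.
  by apply: eq_bigl => W; rewrite !inE -andbA.
have -> : up k (down k.+1 f) V = \sum_(U : T | \dim U == k.+1)
    #|[set K : T | [&& \dim K == k, (K <= V)%VS & (K <= U)%VS]]|%:R * f U.
  rewrite /down /up (exchange_big_dep (fun U : T => \dim U == k.+1)) /=; last first.
    by move=> W U _ /andP[].
  apply: eq_bigr => U dU; rewrite dU mulr_natl -sumr_const.
  by apply: eq_bigl => W; rewrite !inE -andbA.
rewrite (bigD1 V) ?dV //= [in RHS](bigD1 V) ?dV //=.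
have -> : \sum_(U : T | (\dim U == k.+1) && (U != V))
    #|[set W : T | [&& \dim W == k.+2, (V <= W)%VS & (U <= W)%VS]]|%:R * f U =
  \sum_(U : T | (\dim U == k.+1) && (U != V))
    #|[set K : T | [&& \dim K == k, (K <= V)%VS & (K <= U)%VS]]|%:R * f U.
  apply: eq_bigr => U /andP[/eqP dU neq]; congr (_%:R * _).
  by apply: card_common_covers; rewrite // eq_sym.
have -> : #|[set W : T | [&& \dim W == k.+2, (V <= W)%VS & (V <= W)%VS]]| = qnum q (n - k.+1).
  by rewrite -dV -card_covers_full; apply: eq_card => W; rewrite !inE andbb dV.
have -> : #|[set K : T | [&& \dim K == k, (K <= V)%VS & (K <= V)%VS]]| = qnum q k.+1.
  by rewrite -dV -card_facets; apply: eq_card => W; rewrite !inE andbb dV.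
ring.
Qed.

(** Pairing with the constant 1 moves the sum to level k, where each V has [n-k] covers. In
    particular [up] preserves mean zero. *)
Lemma sum_up k f :
  \sum_(W : T | \dim W == k.+1) up k f W
  = (qnum q (n - k))%:R * \sum_(V : T | \dim V == k) f V.
Proof.
transitivity (\sum_(W : T | \dim W == k.+1) 1 * up k f W).
  by apply: eq_bigr => W _; rewrite mul1r.
rewrite up_down_adjoint mulr_sumr; apply: eq_bigr => V /eqP dV; congr (_ * _).
rewrite -dV -card_covers_full /down sumr_const; congr (_%:R).
by apply: eq_card => W; rewrite !inE.
Qed.

Lemma sum_down k f :
  \sum_(V : T | \dim V == k) down k.+1 f V
  = (qnum q k.+1)%:R * \sum_(W : T | \dim W == k.+1) f W.
Proof.
transitivity (\sum_(V : T | \dim V == k) down k.+1 f V * 1).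
  by apply: eq_bigr => W _; rewrite mulr1.
rewrite -(up_down_adjoint k.+1 k (fun _ => 1)) mulr_sumr.
apply: eq_bigr => W /eqP dW; rewrite mulrC; congr (_ * _).
rewrite -dW -card_facets /up sumr_const; congr (_%:R).
by apply: eq_card => V; rewrite !inE dW eqSS.
Qed.

(** With g = D f, adjointness and [down_up] give |U f|^2 = |g|^2 + ([n-k] - [k]) |f|^2 on level k.
    Since g has mean zero by [sum_down], the induction hypothesis one level lower bounds |U g|^2 and
    hence |g|^2. *)
Lemma up_norm_le k f : (k < n)%N -> \sum_(V : T | \dim V == k) f V = 0 ->
  \sum_(W : T | \dim W == k.+1) up k f W ^+ 2
  <= (q * qnum q k * qnum q (n - k.+1))%:R * \sum_(V : T | \dim V == k) f V ^+ 2.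
Proof.
elim: k f => [|k IH] f kn f0.
  (* On level 0 the only subspace is 0, so U f is everywhere the total of f, which vanishes; the
     claimed constant is 0 because [0] = 0. *)
  rewrite [X in (q * X)%N]/qnum big_ord0 muln0 mul0n mul0r big1 // => W _.
  rewrite (_ : up 0 f W = 0) ?expr0n // -f0; apply: eq_bigl => V.
  by apply: andb_idr; rewrite dimv_eq0 => /eqP ->; apply: sub0v.
set S := \sum_(V : T | \dim V == k.+1) _.
pose g := down k.+1 f; pose N := \sum_(V : T | \dim V == k) g V ^+ 2.
have N_up : N = \sum_(V : T | \dim V == k.+1) up k g V * f V.
  rewrite /N; under eq_bigr do rewrite expr2.
  by rewrite -up_down_adjoint; apply: eq_bigr => V _; rewrite mulrC.
have g0 : \sum_(V : T | \dim V == k) g V = 0 by rewrite sum_down f0 mulr0.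
have := IH g (ltnW kn) g0; rewrite -/N; set M := (_%:R) => le_up.
have N_ge0 : 0 <= N by apply: sumr_ge0 => V _; apply: sqr_ge0.
have S_ge0 : 0 <= S by apply: sumr_ge0 => V _; apply: sqr_ge0.
have M_ge0 : 0 <= M by apply: ler0n.
(* N^2 = <U g, f>^2 <= |U g|^2 |f|^2 <= M N S with g = D f. *)
have NM : N <= M * S.
  have := Cauchy_Schwarz_sum (fun V : T => \dim V == k.+1) (up k g) f.
  rewrite -N_up -/S => CS.
  have {}CS := le_trans CS (ler_wpM2r S_ge0 le_up).
  have [Nz|Nn] := eqVneq N 0; first by rewrite Nz mulr_ge0.
  rewrite -(@ler_pM2l _ N) ?lt_def ?Nn //; nra.
have eqUp : \sum_(W : T | \dim W == k.+2) up k.+1 f W ^+ 2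
    = N + ((qnum q (n - k.+1))%:R - (qnum q k.+1)%:R) * S.
  under eq_bigr do rewrite expr2.
  rewrite up_down_adjoint N_up /S mulr_sumr -big_split /=.
  apply: eq_bigr => V /eqP dV; have := down_up f dV; rewrite -/g; nra.
rewrite eqUp; set a := (_%:R) in NM *.
(* The constant q [k] [n-k-1] reproduces itself: raising k by one adds exactly [n-k-1] - [k+1], by
   [m+1] = 1 + q [m]. *)
have -> : (q * qnum q k.+1 * qnum q (n - k.+2))%:R
    = M + ((qnum q (n - k.+1))%:R - (qnum q k.+1)%:R) :> R.
  have -> : (n - k.+1 = (n - k.+2).+1)%N by lia.
  rewrite /M (_ : (n - k.+1 = (n - k.+2).+1)%N); last by lia.
  by rewrite !qnumS !natrM !natrD !natrM; ring.
nra.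
Qed.

(** Incident pairs between the two levels, counted from below and from above. *)
Lemma card_level k :
  (qnum q (n - k))%:R * #|Lnk F n k|%:R = (qnum q k.+1)%:R * #|Lnk F n k.+1|%:R :> R.
Proof.
have cardL j : #|Lnk F n j|%:R = \sum_(V : T | \dim V == j) (1 : R).
  by rewrite sumr_const; congr (_%:R); apply: eq_card => V; rewrite !inE.
rewrite !cardL -sum_up mulr_sumr; apply: eq_bigr => W /eqP dW.
rewrite mulr1 -dW -card_facets /up sumr_const; congr (_%:R).
by apply: eq_card => V; rewrite !inE dW eqSS.
Qed.

Lemma card_level_gt0 k : (k <= n)%N -> (0 < #|Lnk F n k|)%N.
Proof.
move=> kn; have [|U _ dU] := @subspace_of_dim F n fullv k; first by rewrite dim_full.
by apply/card_gt0P; exists U; rewrite inE dU.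
Qed.
End Spectral.

(** * Densities of an ideal on successive levels *)

Section Density.
Variables (R : realType) (F : finFieldType) (n : nat).
Local Notation q := #|F|.
Local Notation T := (linsub F n).
Variable Q : {set linsub F n}.
Hypothesis idQ : is_ideal Q.
Local Notation m := (mu R Q).

Lemma mu_ge0 k : 0 <= m k.
Proof. by rewrite divr_ge0 ?ler0n. Qed.

Lemma mu_le1 k : (k <= n)%N -> m k <= 1.
Proof.
move=> kn; have c0 := card_level_gt0 F kn.
rewrite ler_pdivrMr ?ltr0n // mul1r ler_nat.
by apply: subset_leq_card; apply: subsetIr.
Qed.

Lemma card_mu k : (k <= n)%N -> #|Q :&: Lnk F n k|%:R = m k * #|Lnk F n k|%:R.
Proof. by move=> kn; rewrite divfK // pnatr_eq0 -lt0n card_level_gt0. Qed.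

Lemma sum_ind_level k c : (k <= n)%N ->
  \sum_(V : T | \dim V == k) (if V \in Q then c else 0) = m k * #|Lnk F n k|%:R * c.
Proof.
move=> kn; rewrite -big_mkcondr sumr_const -card_mu // mulr_natl; congr (_ *+ _).
by apply: eq_card => V; rewrite !inE andbC.
Qed.

Lemma sum_cst_level k (c : R) : \sum_(V : T | \dim V == k) c = #|Lnk F n k|%:R * c.
Proof.
by rewrite sumr_const mulr_natl; congr (_ *+ _); apply: eq_card => V; rewrite !inE.
Qed.

(** U f for f = 1_Q - mu_k is paired with g = 1_Q - mu_(k+1). The pairing is computed exactly, and
    Cauchy-Schwarz with [up_norm_le] bounds its square. The odds are cross-multiplied so that
    densities 0 and 1 are covered. *)
Lemma mu_odds k : (k < n)%N ->
  q%:R * m k.+1 * (1 - m k) <= (1 - m k.+1) * m k.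
Proof.
move=> kn.
have qS j : (q%:R * (qnum q j)%:R = (qnum q j.+1)%:R - 1 :> R).
  by rewrite qnumS natrD natrM; ring.
set a := m k.+1; set b := m k.
have a0 : 0 <= a := mu_ge0 _; have a1 : a <= 1 by apply: mu_le1.
have b0 : 0 <= b := mu_ge0 _; have b1 : b <= 1 by apply: mu_le1; lia.
have : a * (1 - b) * ((qnum q k.+1)%:R * (qnum q (n - k))%:R)
   <= (1 - a) * b * (q * qnum q k * qnum q (n - k.+1))%:R.
  pose f (V : T) : R := (if V \in Q then 1 else 0) - b.
  pose g (W : T) : R := (if W \in Q then 1 else 0) - a.
  have lek : (k <= n)%N by lia.
  have f0 : \sum_(V : T | \dim V == k) f V = 0.
    by rewrite sumrB sum_ind_level // sum_cst_level -/b; ring.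
  have f2 : \sum_(V : T | \dim V == k) f V ^+ 2 = b * (1 - b) * #|Lnk F n k|%:R.
    transitivity (\sum_(V : T | \dim V == k) ((if V \in Q then 1 - 2 * b else 0) + b ^+ 2)).
      by apply: eq_bigr => V _; rewrite /f; case: ifP => _; ring.
    by rewrite big_split /= sum_ind_level // sum_cst_level -/b; ring.
  have g2 : \sum_(W : T | \dim W == k.+1) g W ^+ 2 = a * (1 - a) * #|Lnk F n k.+1|%:R.
    transitivity (\sum_(V : T | \dim V == k.+1) ((if V \in Q then 1 - 2 * a else 0) + a ^+ 2)).
      by apply: eq_bigr => V _; rewrite /g; case: ifP => _; ring.
    by rewrite big_split /= sum_ind_level // sum_cst_level -/a; ring.
  (* The ideal property enters here: all [k+1] facets of a W in Q lie in Q, and each contributes 1 -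
     b. *)
  have upQ (W : T) : \dim W = k.+1 -> W \in Q -> up k f W = (1 - b) * (qnum q k.+1)%:R.
    move=> dW WQ; rewrite -dW -card_facets mulr_natr -sumr_const.
    rewrite /up; apply: eq_big => V; first by rewrite !inE dW eqSS.
    by move=> /andP[_ VW]; rewrite /f (idQ WQ VW).
  (* The constant part of g pairs to 0, since U f has sum zero. *)
  have gf : \sum_(W : T | \dim W == k.+1) g W * up k f W
      = a * #|Lnk F n k.+1|%:R * ((1 - b) * (qnum q k.+1)%:R).
    transitivity (\sum_(W : T | \dim W == k.+1)
        ((if W \in Q then (1 - b) * (qnum q k.+1)%:R else 0) - a * up k f W)).
      apply: eq_bigr => W /eqP dW; rewrite /g.
      by case: ifP => [/(upQ _ dW) ->|_]; ring.
    by rewrite sumrB sum_ind_level // -mulr_sumr sum_up f0 !mulr0 subr0.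
  have := Cauchy_Schwarz_sum (fun W : T => \dim W == k.+1) g (up k f).
  rewrite gf g2; have := up_norm_le kn f0; rewrite f2.
  have cl := card_level R F n k.
  have N1 : 0 < #|Lnk F n k.+1|%:R :> R by rewrite ltr0n card_level_gt0.
  have N0 : 0 < #|Lnk F n k|%:R :> R by rewrite ltr0n card_level_gt0.
  have c0 : 0 < (qnum q k.+1)%:R :> R by rewrite ltr0n qnumS.
  have d0 : 0 < (qnum q (n - k))%:R :> R.
    by rewrite ltr0n (_ : (n - k)%N = (n - k.+1).+1) ?qnumS //; lia.
  have M0 : 0 <= (q * qnum q k * qnum q (n - k.+1))%:R :> R by apply: ler0n.
  move: cl N1 N0 c0 d0 M0.
  move: (#|Lnk F n k.+1|%:R) (#|Lnk F n k|%:R) => N1 N0.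
  move: (\sum_(i | _) _) => X.
  move: ((qnum q k.+1)%:R) ((qnum q (n - k))%:R) ((q * qnum q k * qnum q (n - k.+1))%:R).
  move=> c d M cl N1p N0p cp dp M0 leX CS.
  have [ab0|abn] := eqVneq (a * (1 - b)) 0.
    by rewrite ab0 mul0r !mulr_ge0 // subr_ge0.
  have abp : 0 < a * (1 - b) by rewrite lt_def abn mulr_ge0 // subr_ge0.
  (* This multiplier turns the left side into d times the square in Cauchy-Schwarz; on the right,
     [cl] trades c N1 for d N0 to match the norm bound. *)
  rewrite -(@ler_pM2l _ (a * (1 - b) * N1 ^+ 2 * c)); last first.
    by apply: mulr_gt0 => //; apply: mulr_gt0 => //; rewrite exprn_gt0.
  have -> : a * (1 - b) * N1 ^+ 2 * c * (a * (1 - b) * (c * d))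
      = d * (a * N1 * ((1 - b) * c)) ^+ 2 by ring.
  apply: le_trans (ler_wpM2l (ltW dp) CS) _.
  have -> : a * (1 - b) * N1 ^+ 2 * c * ((1 - a) * b * M)
      = d * (a * (1 - a) * N1 * (M * (b * (1 - b) * N0))).
    by transitivity (a * (1 - b) * N1 * (c * N1) * ((1 - a) * b * M)); [ring | rewrite -cl; ring].
  apply: ler_wpM2l; first exact: ltW.
  apply: ler_wpM2l leX.
  by rewrite !mulr_ge0 ?subr_ge0 // ltW.
rewrite !natrM.
rewrite (_ : (n - k)%N = (n - k.+1).+1); last by lia.
have := qS k; have := qS (n - k.+1)%N.
have r0 : 0 <= q%:R :> R by apply: ler0n.
have : 1 <= (qnum q k.+1)%:R :> R by rewrite ler1n qnumS.
have : 1 <= (qnum q (n - k.+1).+1)%:R :> R by rewrite ler1n qnumS.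
move: ((qnum q k)%:R) ((qnum q (n - k.+1))%:R) ((qnum q k.+1)%:R) ((qnum q (n - k.+1).+1)%:R).
move: (q%:R) r0 => r r0 c d c' d' d1 c1 rd rc H.
(* After a further factor q the right-hand constant is (q [k]) (q [n-k-1]) = ([k+1] - 1) ([n-k] -
   1), at most [k+1] [n-k]. This is the gain of q in the odds. *)
have cd0 : 0 < c' * d' by nra.
rewrite -(ler_pM2r cd0).
have -> : r * a * (1 - b) * (c' * d') = r * (a * (1 - b) * (c' * d')) by ring.
apply: le_trans (ler_wpM2l r0 H) _.
have -> : r * ((1 - a) * b * (r * c * d)) = (1 - a) * b * ((r * c) * (r * d)) by ring.
rewrite rc rd; apply: ler_wpM2l; first by rewrite mulr_ge0 // subr_ge0.
nra.
Qed.

(** The inequality for j steps is multiplied by [mu_odds] at level k+j, and the factor b (1 - b) of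
    the middle level cancels. *)
Lemma mu_odds_iter k j : (k + j <= n)%N ->
  q%:R ^+ j * m (k + j)%N * (1 - m k) <= (1 - m (k + j)%N) * m k.
Proof.
elim: j => [|j IH] kj; first by rewrite addn0 expr0 mul1r mulrC.
have {IH} := IH ltac:(lia).
have := @mu_odds (k + j)%N ltac:(lia).
rewrite addnS; have := mu_ge0 k; have := @mu_le1 k ltac:(lia).
have := mu_ge0 (k + j); have := @mu_le1 (k + j) ltac:(lia).
have := mu_ge0 (k + j).+1; have := @mu_le1 (k + j).+1 ltac:(lia).
have : 0 < q%:R :> R by rewrite ltr0n; apply: ltnW (finNzRing_gt1 _).
rewrite exprS; move: (m k) (m (k + j)%N) (m (k + j).+1) (q%:R) => a b c r r0 c1 c0 b1 b0 a1 a0.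
have : 0 < r ^+ j by rewrite exprn_gt0.
move: (r ^+ j) => s s0 H1 H2.
(* Where b (1 - b) = 0 nothing can be cancelled: b = 0 forces c = 0 one level up, b = 1 forces a = 1
   at level k, and either makes the claim trivial. *)
have [bz|bn] := eqVneq b 0.
  have -> : c = 0 by move: H1; rewrite bz; nra.
  by nra.
have [b1'|b1n] := eqVneq b 1.
  have -> : a = 1 by move: H2; rewrite b1'; nra.
  by nra.
have bp : 0 < b by rewrite lt_def bn.
have bp' : 0 < 1 - b by rewrite subr_gt0 lt_def eq_sym b1n.
have bbp : 0 < b * (1 - b) by rewrite mulr_gt0.
rewrite -(ler_pM2l bbp).
have -> : b * (1 - b) * (r * s * c * (1 - a)) = (r * c * (1 - b)) * (s * b * (1 - a)) by ring.
have -> : b * (1 - b) * ((1 - c) * a) = ((1 - c) * b) * ((1 - b) * a) by ring.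
by apply: ler_pM => //; rewrite !mulr_ge0 ?subr_ge0 // ltW.
Qed.

End Density.

(** * The one-level bounds and the threshold *)

Theorem theorem2 (R : realType) :
  (forall (F : finFieldType) (n : nat) (Q : {set linsub F n}) (k : nat) (z : R),
      (1 <= n)%N -> is_ideal Q -> (1 <= k)%N -> (k <= n - 1)%N ->
      0 <= z -> mu R Q k = (1 + z)^-1 ->
      mu R Q k.-1 >= (1 + z / (qof F)%:R)^-1 /\
      mu R Q k.+1 <= (1 + (qof F)%:R * z)^-1)
  /\
  (exists C : R, 0 < C /\
    forall (F : finFieldType) (n : nat) (eps : R) (Q : {set linsub F n}) (k l : nat),
      (1 <= n)%N -> 0 < eps < 1 -> is_ideal Q -> (k <= l <= n)%N ->
      mu R Q k <= 1 - eps ->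
      l%:R >= k%:R + C * (ln (eps^-1) / ln (qof F)%:R) ->
      mu R Q l <= eps).
Proof.
split=> [F n Q k z n1 idQ k1 kn z0 muk|].
  have q0 : 0 < (qof F)%:R :> R by rewrite ltr0n; apply: ltnW (finNzRing_gt1 _).
  have z1 : 0 < 1 + z by lra.
  (* So z is the odds against membership at level k; [mu_odds] at k-1 and at k then gives the two
     bounds. *)
  have odds : 1 - mu R Q k = z * mu R Q k by rewrite muk; field; rewrite gt_eqF.
  have mk0 : 0 < mu R Q k by rewrite muk invr_gt0.
  split.
    have := @mu_odds R F n Q idQ k.-1 ltac:(lia).
    rewrite prednK // odds -/(qof F).
    rewrite [leRHS](_ : _ = z * mu R Q k.-1 * mu R Q k); last by ring.
    rewrite [leLHS]mulrAC ler_pM2r // => H.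
    have zq : 0 <= z / (qof F)%:R by rewrite divr_ge0 // ltW.
    rewrite -[leLHS]mul1r ler_pdivrMr; last by lra.
    move: H; rewrite [leRHS](_ : _ = (qof F)%:R * (z / (qof F)%:R * mu R Q k.-1)); last first.
      by field; rewrite gt_eqF.
    by rewrite ler_pM2l // => H; lra.
  have := @mu_odds R F n Q idQ k ltac:(lia).
  rewrite odds -/(qof F) mulrA ler_pM2r // => H.
  have qz : 0 <= (qof F)%:R * z by rewrite mulr_ge0 // ltW.
  rewrite -[leRHS]mul1r ler_pdivlMr; last by lra.
  nra.
(* C = 2 gives q^(l-k) >= eps^(-2): one power of 1/eps is spent on 1 - mu_k >= eps, the other
   remains as the bound on mu_l. *)
exists 2; split=> // F n e Q k l n1 /andP[e0 e1] idQ /andP[kl ll] muk lek.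
have q1 : 1 < (qof F)%:R :> R by rewrite ltr1n; apply: finNzRing_gt1.
have q0 := lt_trans ltr01 q1.
pose j := (l - k)%N.
have lkj : l = (k + j)%N by rewrite /j; lia.
have lnq : 0 < ln (qof F)%:R :> R by apply: ln_gt0.
have eq_j : (e ^+ 2)^-1 <= (qof F)%:R ^+ j :> R.
  rewrite -ler_ln ?posrE ?invr_gt0 ?exprn_gt0 // -exprVn !lnXn ?invr_gt0 //.
  rewrite -[leRHS]mulr_natl -ler_pdivrMr // -[_ *+ 2]mulr_natl -mulrA.
  by move: lek; rewrite lkj natrD lerD2l.
have := @mu_odds_iter R F n Q idQ k j ltac:(lia); rewrite -lkj.
have := mu_ge0 R Q l; have := mu_le1 R Q ll; have := mu_ge0 R Q k.
move: eq_j; rewrite -/(qof F) -[_^-1]mul1r ler_pdivrMr ?exprn_gt0 //.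
have s0 : 0 <= (qof F)%:R ^+ j :> R by rewrite exprn_ge0 // ltW.
move: (mu R Q l) (mu R Q k) muk ((qof F)%:R ^+ j) s0 => b a ae s s0 a0 b1 b0 se H.
have sb0 : 0 <= s * b by rewrite mulr_ge0.
have sbe : s * b * e <= 1.
  apply: le_trans (_ : s * b * (1 - a) <= _); first by apply: ler_wpM2l => //; lra.
  by apply: le_trans H _; nra.
(* This fact and the next chain to b <= s b e^2 <= e. *)
have be0 : 0 <= b * (s * e ^+ 2 - 1) by rewrite mulr_ge0 ?subr_ge0.
have se0 : 0 <= e * (1 - s * b * e) by rewrite mulr_ge0 ?subr_ge0 // ltW.
nra.
Qed.
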